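(* Let $L>0$ and let $f\colon\mathbb{R}^n\to\mathbb{R}$ be convex and $L$-smooth with $\operatorname{argmin} f\neq\emptyset$. Let $\{t_k\}_{k\ge 0}$ be a sequence of positive real numbers with $t_0=1$, $t_{k+1}^2-t_{k+1}\le t_k^2$ for all $k=0,1,\dots$, and $t_k\to\infty$ as $k\to\infty$. Let $x_0=y_0\in\mathbb{R}^n$ and let $\{x_k\}_{k\ge0}$, $\{y_k\}_{k\ge0}$ be generated by the Nesterov accelerated gradient method $$x_{k+1}=y_k-\frac1L\nabla f(y_k),\qquad y_{k+1}=x_{k+1}+\frac{t_k-1}{t_{k+1}}(x_{k+1}-x_k)\qquad\text{for }k=0,1,\dots.$$ Then $\{x_k\}_{k\ge 0}$ and $\{y_k\}_{k\ge 0}$ converge to the same minimizer of $f$; that is, there exists $x_\infty\in\operatorname{argmin} f$ such that $x_k\to x_\infty$ and $y_k\to x_\infty$ as $k\to\infty$.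
   Context: $\mathbb{R}^n$ carries the Euclidean inner product and norm $\|\cdot\|$. $f$ is $L$-smooth if it is differentiable and $\|\nabla f(x)-\nabla f(y)\|\le L\|x-y\|$ for all $x,y\in\mathbb{R}^n$. $\operatorname{argmin} f$ denotes the set of minimizers of $f$ over $\mathbb{R}^n$. *)

(* Defs.v *)
From HB Require Import structures.
From mathcomp Require Import all_boot all_order all_algebra.
From mathcomp Require Import all_classical all_reals all_analysis.
Set Implicit Arguments.
Unset Strict Implicit.
Unset Printing Implicit Defensive.
Import Order.TTheory GRing.Theory Num.Theory.
Import numFieldNormedType.Exports.
Local Open Scope classical_set_scope.
Local Open Scope ring_scope.

(* The canonical norm `|v| on 'rV[R]_n is the sup norm, so the Euclidean inner
   product and norm are introduced here. Both norms induce the canonical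
   topology of 'rV[R]_n, see [cvg_enormP] below. *)
Definition dotv (R : realType) (n : nat) (u v : 'rV[R]_n) : R :=
  \sum_(i < n) u 0 i * v 0 i.

Definition enorm (R : realType) (n : nat) (v : 'rV[R]_n) : R :=
  Num.sqrt (dotv v v).

Definition gradient (R : realType) (n : nat) (f : 'rV[R]_n -> R^o)
    (x : 'rV[R]_n) : 'rV[R]_n :=
  \row_(i < n) 'D_(delta_mx 0 i) f x.

Definition Lsmooth (R : realType) (n : nat) (L : R) (f : 'rV[R]_n -> R^o) :
    Prop :=
  (forall x, differentiable f x) /\
  (forall x y, enorm (gradient f x - gradient f y) <= L * enorm (x - y)).

Definition argmin (R : realType) (n : nat) (f : 'rV[R]_n -> R^o) :
    set 'rV[R]_n :=
  [set x | forall y, f x <= f y].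

Lemma diff_gradient (R : realType) (n : nat) (f : 'rV[R]_n -> R^o)
    (x v : 'rV[R]_n) :
  differentiable f x -> 'd f x v = dotv (gradient f x) v.
Proof.
move=> df; rewrite {1}(row_sum_delta v) linear_sum.
apply: eq_bigr => i _.
by rewrite linearZ mxE deriveE// mulrC.
Qed.

Lemma enorm_ge_coord (R : realType) (n : nat) (v : 'rV[R]_n) (i : 'I_n) :
  `|v 0 i| <= enorm v.
Proof.
rewrite -sqrtr_sqr ler_wsqrtr// /dotv (bigD1 i)//= -expr2 lerDl.
by apply: sumr_ge0 => j _; rewrite -expr2 sqr_ge0.
Qed.

Lemma cvg_enormP (R : realType) (n : nat) (u : nat -> 'rV[R]_n)
    (l : 'rV[R]_n) :
  (u @ \oo --> l) <-> ((fun k => enorm (u k - l)) @ \oo --> (0 : R)).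
Proof.
split=> [ul|ul].
- rewrite -sqrtr0.
  apply: (@continuous_cvg _ _ _ _ _ (fun k => dotv (u k - l) (u k - l)) Num.sqrt).
    exact: sqrt_continuous.
  have -> : (0 : R) = \sum_(i < n) (0 : R) * 0.
    by rewrite big1// => i _; rewrite mul0r.
  apply: cvg_big => [|i _]; first exact: add_continuous.
  have c : (fun k => (u k - l) 0 i) @ \oo --> (0 : R).
    rewrite -[X in _ --> X](subrr (l 0 i)).
    under eq_fun do rewrite !mxE.
    apply: cvgB; last exact: cvg_cst.
    exact: (continuous_cvg _ (@coord_continuous _ _ _ 0 i l) ul).
  exact: cvgM.
- apply/cvgrPdist_lt => e e0.
  move/cvgrPdist_lt : ul => /(_ e e0).
  apply: filterS => k; rewrite sub0r normrN => ke.
  rewrite distrC {1}/Num.Def.normr/= mx_normrE.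
  apply/bigmax_ltP; split=> // -[i j] _ /=; rewrite (ord1 i).
  apply: le_lt_trans (enorm_ge_coord _ _) _.
  exact: le_lt_trans (ler_norm _) ke.
Qed.

(* Main.v *)
Require Import Defs.
From HB Require Import structures.
From mathcomp Require Import all_boot all_order all_algebra.
From mathcomp Require Import all_classical all_reals all_analysis.
From mathcomp Require Import ring lra.
(* Let w_k = x_k + t_k (x_{k+1} - x_k). For every minimizer a the energy
   E_k(a) = t_k^2 (f(x_{k+1}) - f(a)) + L/2 |w_k - a|^2 is nonincreasing as soon
   as t_k >= 1, hence convergent; since t_k -> oo, f(x_k) tends to min f and all
   cluster points of the bounded sequence x are minimizers. For two minimizers
   a, b, the difference E_k(b) - E_k(a) is affine in <w_k, a - b>, so the latter
   converges. As x_{k+1} = (1 - 1/t_k) x_k + (1/t_k) w_k with sum 1/t_k = oo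
   (because t_k <= k + 1), <x_k, a - b> converges as well. If a and b are
   cluster points of x, this gives <a, a - b> = <b, a - b>, i.e. a = b. *)
Set Implicit Arguments.
Unset Strict Implicit.
Unset Printing Implicit Defensive.
Import Order.TTheory GRing.Theory Num.Theory.
Import numFieldNormedType.Exports.
Local Open Scope classical_set_scope.
Local Open Scope ring_scope.

(** * Bilinearity and continuity of the Euclidean inner product *)

Section Dotv.
Variables (R : realType) (n : nat).
Implicit Types u v w : 'rV[R]_n.

Lemma dotvC u v : dotv u v = dotv v u.
Proof. by apply: eq_bigr => i _; rewrite mulrC. Qed.

Lemma dotvDl u v w : dotv (u + v) w = dotv u w + dotv v w.
Proof. by rewrite -big_split; apply: eq_bigr => i _; rewrite mxE mulrDl. Qed.

Lemma dotvZl a u w : dotv (a *: u) w = a * dotv u w.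
Proof. by rewrite mulr_sumr; apply: eq_bigr => i _; rewrite mxE mulrA. Qed.

Lemma dotvNl u w : dotv (- u) w = - dotv u w.
Proof. by rewrite -scaleN1r dotvZl mulN1r. Qed.

Lemma dotvBl u v w : dotv (u - v) w = dotv u w - dotv v w.
Proof. by rewrite dotvDl dotvNl. Qed.

Lemma dotvDr u v w : dotv w (u + v) = dotv w u + dotv w v.
Proof. by rewrite !(dotvC w) dotvDl. Qed.

Lemma dotvZr a u w : dotv w (a *: u) = a * dotv w u.
Proof. by rewrite !(dotvC w) dotvZl. Qed.

Lemma dotvNr u w : dotv w (- u) = - dotv w u.
Proof. by rewrite !(dotvC w) dotvNl. Qed.

Lemma dotvv_ge0 u : 0 <= dotv u u.
Proof. by apply: sumr_ge0 => i _; rewrite -expr2 sqr_ge0. Qed.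

Lemma dotvv_eq0 u : dotv u u = 0 -> u = 0.
Proof.
move=> /eqP; rewrite psumr_eq0 => [/allP u0|i _]; last by rewrite -expr2 sqr_ge0.
apply/rowP => i; rewrite mxE; apply/eqP.
by have := u0 i (mem_index_enum _); rewrite -expr2 sqrf_eq0.
Qed.

(** Energy bounds are Euclidean, whereas boundedness and compactness below refer to the sup norm. *)
Lemma mx_norm_le_enorm u : `|u| <= enorm u.
Proof.
rewrite {1}/Num.Def.normr/= mx_normrE.
apply/bigmax_leP; split=> [|[i j] _ /=]; first exact: sqrtr_ge0.
by rewrite (ord1 i) enorm_ge_coord.
Qed.

Lemma dotv_continuous v : continuous (fun u => dotv u v).
Proof.
apply: continuous_big => [|i _ u]; first exact: add_continuous.
by apply: (@cvgM _ _ (nbhs u)); [exact: (@coord_continuous R 1 n 0 i u)|exact: cvg_cst].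
Qed.

End Dotv.

Definition dotvE := (dotvDl, dotvDr, dotvNl, dotvNr, dotvZl, dotvZr).

(** * First-order inequalities for convex and for smooth functions *)

Section Smooth.
Variables (R : realType) (n : nat) (L : R) (f : 'rV[R]_n -> R^o).

Lemma is_derive_line (x v : 'rV[R]_n) (s : R) :
  differentiable f (x + s *: v) ->
  is_derive s 1 (fun r : R => f (x + r *: v) : R)
    (dotv (gradient f (x + s *: v)) v).
Proof.
move=> df.
have E : (fun h : R => h^-1 *: (((fun r : R => f (x + r *: v) : R) \o shift s)
      (h *: 1) - f (x + s *: v))) =
    (fun h : R => h^-1 *: ((f \o shift (x + s *: v)) (h *: v) - f (x + s *: v))).
  apply/funext => h /=; congr (_ *: (f _ - _)).
  by rewrite [_ *: 1]mulr1 scalerDl addrCA.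
split; first by rewrite /derivable E; exact: diff_derivable.
by rewrite -diff_gradient// -deriveE// /derive E.
Qed.

(** By convexity the difference quotients of [f] at [x] along [y - x] with step in (0, 1] are at
    most [f y - f x]; let the step tend to 0 from the right. *)
Lemma convex_gradient_le (x y : 'rV[R]_n) :
  convex_function [set: convex_lmodType 'rV[R]_n] f ->
  differentiable f x ->
  f x + dotv (gradient f x) (y - x) <= f y.
Proof.
move=> cf df; rewrite -diff_gradient// -deriveE// addrC -lerBrDr.
have dfv : derivable f x (y - x) by exact: diff_derivable.
apply: (cvgr_to_le (cvg_dnbhs_at_right dfv)).
near=> h => /=.
have h0 : 0 < h by [].
have h1 : h <= 1 by near: h; exact: nbhs_right_le.
rewrite /GRing.scale/= ler_pdivrMl//.
have := cf (Itv01 (ltW h0) h1) y x (in_setT _) (in_setT _).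
rewrite convRE /= /unstable.onem /conv/= /unstable.onem.
have -> : h *: y + (1 - h) *: x = h *: (y - x) + x.
  by rewrite scalerBr scalerBl scale1r addrA addrAC.
by lra.
Unshelve. all: by end_near. Qed.

(** Along the segment, [f] minus the linear and quadratic terms of the bound is a function [g] whose
    derivative is nonpositive on (0, 1). *)
Lemma smooth_descent (x v : 'rV[R]_n) : 0 < L -> Lsmooth L f ->
  f (x + v) <= f x + dotv (gradient f x) v + L / 2 * dotv v v.
Proof.
move=> L0 [df lipf].
pose g (s : R) : R := f (x + s *: v) - s * dotv (gradient f x) v
  - L / 2 * dotv v v * s ^+ 2.
have dg (s : R) : is_derive s 1 g (dotv (gradient f (x + s *: v)) v
    - dotv (gradient f x) v - L * s * dotv v v).
  have dl := @is_derive_line x v s (df _).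
  rewrite [g](_ : _ = (fun r => f (x + r *: v) : R)
     - dotv (gradient f x) v \*: id - (L / 2 * dotv v v) \*: (id ^+ 2)); last first.
    apply/funext => r.
    by rewrite /g (mulrC r).
  apply: is_derive_eq.
  by rewrite /GRing.scale/= expr1; lra.
suff : g 1 <= g 0.
  by rewrite /g !(scale1r, scale0r, addr0); lra.
apply: (@ler0_derive1_le_cc _ g 0 1).
- by move=> s _; exact: ex_derive.
- move=> s; rewrite in_itv/= => /andP[s0 s1]; rewrite derive1E derive_val.
  set G := gradient f (x + s *: v) - gradient f x.
  have GL : dotv G G <= (L * s) ^+ 2 * dotv v v.
    have := lipf (x + s *: v) x; rewrite -/G addrAC subrr add0r -ler_sqr.
    - by rewrite exprMn !sqr_sqrtr ?dotvv_ge0// !dotvE; lra.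
    - by rewrite nnegrE sqrtr_ge0.
    - by rewrite nnegrE mulr_ge0 ?sqrtr_ge0// ltW.
  rewrite -dotvBl -/G; clearbody G.
  (* Expanding this square and inserting [GL] gives [dotv G v <= L * s * dotv v v], in place of
     Cauchy-Schwarz. *)
  have := dotvv_ge0 (G - (L * s) *: v).
  rewrite !dotvE (dotvC v G).
  have Ls : 0 < L * s by rewrite mulr_gt0.
  by nra.
- by apply: derivable_within_continuous => s _; exact: ex_derive.
- by rewrite in_itv/= lexx ler01.
- by rewrite in_itv/= lexx ler01.
- exact: ler01.
Qed.

End Smooth.

(** * Convergence criteria and the one-step energy estimate *)

(** Continuity makes [h a] a cluster point of [h @ F], and a convergent filter in a Hausdorff space
    clusters only at its limit. *)
Lemma cluster_continuous_cvg (T : topologicalType) (R : realType)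
    (F : set_system T) (h : T -> R) (a : T) (c : R) : Filter F ->
  cluster F a -> {for a, continuous h} -> h @ F --> c -> h a = c.
Proof.
move=> FF aF ha hc; apply: (@Rhausdorff R) => A B hA cB.
have [z [Fz Az]] := aF _ _ (hc _ cB) (ha _ hA).
by exists (h z).
Qed.

Lemma weighted_average_cvg (R : realType) (t h w : nat -> R) (c : R) :
  (forall k, 0 < t k) -> (forall k, t k <= k.+1%:R) ->
  (\forall k \near \oo, 1 <= t k) ->
  (forall k, h k.+1 = h k + (t k)^-1 * (w k - h k)) ->
  w @ \oo --> c -> h @ \oo --> c.
Proof.
move=> t0 tk t1 hE /cvgrPdist_le wc; apply/cvgrPdist_le => e e0.
have e20 : 0 < e / 2 by rewrite divr_gt0.
have [N _ HN] := filterI t1 (wc _ e20).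
pose p k := `|c - h k| - e / 2.
(* For [k >= N], [p_k.+1 <= (1 - 1 / t k) p_k] and [1 - 1 / t k <= k / k.+1],
   so [k p_k] stays bounded. *)
pose M := N%:R * Num.max 0 (p N).
have pM k : (N <= k)%N -> k%:R * p k <= M.
  elim: k => [|k IH].
    by move=> _; rewrite mul0r mulr_ge0// le_max lexx.
  rewrite leq_eqVlt => /predU1P[<-|]; first by rewrite ler_wpM2l// le_max lexx orbT.
  rewrite ltnS => Nk; have [tk1 wk] := HN _ Nk; have {}IH := IH Nk.
  have a0 : 0 < (t k)^-1 by rewrite invr_gt0.
  have a1 : (t k)^-1 <= 1 by rewrite invf_le1.
  have ak : 1 <= (t k)^-1 * k.+1%:R by rewrite mulrC ler_pdivlMr// mul1r.
  have M0 : 0 <= M by rewrite mulr_ge0// le_max lexx.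
  have pS : p k.+1 <= (1 - (t k)^-1) * p k.
    rewrite /p hE.
    have -> : c - (h k + (t k)^-1 * (w k - h k)) =
        (1 - (t k)^-1) * (c - h k) + (t k)^-1 * (c - w k) by ring.
    have := ler_normD ((1 - (t k)^-1) * (c - h k)) ((t k)^-1 * (c - w k)).
    rewrite !normrM (ger0_norm (ltW a0)) (@ger0_norm _ (1 - (t k)^-1)) ?subr_ge0//.
    by move: wk => /=; nra.
  apply: (@le_trans _ _ (k.+1%:R * ((1 - (t k)^-1) * p k))).
    by rewrite ler_wpM2l.
  have [pk0|pk0] := leP 0 (p k).
    apply: le_trans IH; rewrite mulrA ler_wpM2r//.
    by rewrite -natr1 in ak *; lra.
  apply: le_trans M0; rewrite pmulr_rle0// mulr_ge0_le0 ?subr_ge0//; exact: ltW.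
near=> k.
have Nk : (N <= k)%N by near: k; exact: nbhs_infty_ge.
have k0 : 0 < k%:R :> R by rewrite ltr0n; near: k; exact: nbhs_infty_gt.
have kM : M / (e / 2) <= k%:R by near: k; exact: nbhs_infty_ger.
have := pM _ Nk; rewrite ler_pdivrMr// in kM => kp.
have : p k <= e / 2.
  by rewrite -(ler_pM2l k0) (le_trans kp).
by rewrite /p; lra.
Unshelve. all: by end_near. Qed.

(** Add the descent inequality at [y] with weight t^2 and the gradient inequalities at [y] towards
    [x] and [a] with weights t^2 - t and t. The relation for [t *: y] reduces the inner products to
    [- t * dotv g (w - a)], which, like the squared gradient, cancels against the expansion of |w' -
    a|^2. *)
Lemma nesterov_energy_step (R : realType) (n : nat) (L : R)
    (f : 'rV[R]_n -> R^o) (t : R) (a x y w x' w' : 'rV[R]_n) :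
  0 < L -> convex_function [set: convex_lmodType 'rV[R]_n] f -> Lsmooth L f ->
  1 <= t -> t *: y = (t - 1) *: x + w ->
  x' = y - L^-1 *: gradient f y -> w' = w - (t / L) *: gradient f y ->
  t ^+ 2 * (f x' - f a) + L / 2 * dotv (w' - a) (w' - a)
  <= (t ^+ 2 - t) * (f x - f a) + L / 2 * dotv (w - a) (w - a).
Proof.
move=> L0 cf sf t1 ty -> ->; rewrite [w - _ - a]addrAC.
set g := gradient f y; set u := w - a.
have [df _] := sf.
have D := smooth_descent y (- (L^-1 *: g)) L0 sf.
have Cx := convex_gradient_le x cf (df y).
have Ca := convex_gradient_le a cf (df y).
have Hw : t * dotv g y = (t - 1) * dotv g x + dotv g u + dotv g a.
  by rewrite -dotvZr ty /u !dotvE; ring.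
rewrite -/g in D Cx Ca; clearbody u g.
move: D Cx Ca; rewrite !dotvE (dotvC u g).
move: (f (y - _)) (f x) (f y) (f a) Hw => fx' fx fy fa Hw D Cx Ca.
move: (dotv g g) (dotv g u) (dotv g y) (dotv g x) (dotv g a) (dotv u u)
  Hw D Cx Ca => gg gu gy gx ga uu Hw D Cx Ca.
have {}D : fx' <= fy - L^-1 / 2 * gg.
  apply: le_trans D _; rewrite le_eqVlt; apply/orP; left; apply/eqP; field.
  exact: lt0r_neq0.
have -> : L / 2 * (uu - t / L * gu - t / L * (gu - t / L * gg)) =
    L / 2 * uu - t * gu + t ^+ 2 * (L^-1 / 2 * gg).
  by field; exact: lt0r_neq0.
have {}D := @ler_wpM2l R _ (sqr_ge0 t) _ _ D.
have tt : 0 <= t ^+ 2 - t by nra.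
have {}Cx := @ler_wpM2l R _ tt _ _ Cx.
have t0 : 0 <= t by lra.
have {}Ca := @ler_wpM2l R _ t0 _ _ Ca.
have {}Hw : t * (t * gy) = t * ((t - 1) * gx + gu + ga) by rewrite Hw.
by nra.
Qed.

Lemma bounded_unique_cluster_cvg (R : realType) (n : nat)
    (u : nat -> 'rV[R]_n) (M : R) :
  (\forall k \near \oo, `|u k| <= M) ->
  (forall a b, cluster (u @ \oo) a -> cluster (u @ \oo) b -> a = b) ->
  exists2 a, cluster (u @ \oo) a & u @ \oo --> a.
Proof.
move=> uM uniq_cluster.
have compact_ball r : compact [set v : 'rV[R]_n | `|v| <= r].
  apply: bounded_closed_compact.
    by exists r; split=> [|s rs v /= vr]; [exact: num_real|exact: le_trans (ltW rs)].
  have /continuous_closedP cl : continuous (fun v : 'rV[R]_n => `|v|).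
    exact: norm_continuous.
  exact: cl _ (@closed_le R r).
have [a [aM ca]] := compact_ball M (u @ \oo) _ uM.
exists a => //.
(* The radius is enlarged by 1 so that the compact ball is a neighbourhood of [a]. *)
apply: (@compact_cluster_set1 _ a _ [set v | `|v| <= M + 1]) => //.
- apply: (@filterS _ _ _ (ball a 1)); last exact: nbhsx_ballx.
  move=> v; rewrite -ball_normE /= => av.
  rewrite -(subrK a v) (le_trans (ler_normD _ _))// addrC lerD//.
  by rewrite distrC ltW.
- by apply: filterS uM => k /= uk; rewrite ler_wpDr.
- by apply/seteqP; split=> [b cb|b ->//] /=; exact: uniq_cluster.
Qed.

(** * Convergence of the accelerated gradient iterates *)

Section Nesterov.
Context (R : realType) (n : nat) (L : R) (f : 'rV[R]_n -> R^o)
  (t : nat -> R) (x y : nat -> 'rV[R]_n).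
Hypothesis L_gt0 : 0 < L.
Hypothesis convex_f : convex_function [set: convex_lmodType 'rV[R]_n] f.
Hypothesis smooth_f : Lsmooth L f.
Hypothesis t_gt0 : forall k, 0 < t k.
Hypothesis t0 : t 0%N = 1.
Hypothesis t_rec : forall k, t k.+1 ^+ 2 - t k.+1 <= t k ^+ 2.
Hypothesis t_cvgy : t k @[k --> \oo] --> +oo.
Hypothesis x_rec : forall k, x k.+1 = y k - L^-1 *: gradient f (y k).
Hypothesis y_rec : forall k,
  y k.+1 = x k.+1 + ((t k - 1) / t k.+1) *: (x k.+1 - x k).

Let w k := x k + t k *: (x k.+1 - x k).
Let E a k := t k ^+ 2 * (f (x k.+1) - f a) + L / 2 * dotv (w k - a) (w k - a).

Let tV_cvg0 : (fun k => (t k)^-1) @ \oo --> (0 : R).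
Proof. by apply/gtr0_cvgV0 => //; exact: nearW. Qed.

Let t_ge1 : \forall k \near \oo, 1 <= t k.
Proof. by move/cvgryPge: t_cvgy; exact. Qed.

(** If t_{k+1} > k + 2, then t_{k+1} (t_{k+1} - 1) > (k + 2)(k + 1) > (k + 1)^2 >= t_k^2, against
    [t_rec]. *)
Let t_le k : t k <= k.+1%:R.
Proof.
elim: k => [|k IH]; first by rewrite t0.
have := t_rec k; have := t_gt0 k; have := t_gt0 k.+1.
by rewrite -natr1; nra.
Qed.

Let x_average k : x k.+1 = x k + (t k)^-1 *: (w k - x k).
Proof.
rewrite /w [_ - x k]addrAC subrr add0r scalerA mulVf ?scale1r ?gt_eqF//.
by rewrite addrC subrK.
Qed.

(** This is the relation between the three points that [nesterov_energy_step] requires. *)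
Let y_average k : t k.+1 *: y k.+1 = (t k.+1 - 1) *: x k.+1 + w k.
Proof.
rewrite y_rec scalerDr scalerA mulrCA mulfV ?mulr1 ?gt_eqF// /w.
rewrite !scalerBl !scalerBr !scale1r; apply/rowP => i; rewrite !mxE; ring.
Qed.

Let w_rec k : w k.+1 = w k - (t k.+1 / L) *: gradient f (y k.+1).
Proof.
have -> : w k = t k.+1 *: y k.+1 - (t k.+1 - 1) *: x k.+1.
  by rewrite y_average addrC addKr.
rewrite [w k.+1]/w (x_rec k.+1); apply/rowP => i; rewrite !mxE; ring.
Qed.

(** Minimality of [a] makes the function gap nonnegative, so [t_rec] allows its coefficient
    t_{k+1}^2 - t_{k+1} to be raised to t_k^2. *)
Let E_nonincr a k : argmin f a -> 1 <= t k.+1 -> E a k.+1 <= E a k.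
Proof.
move=> fa t1.
apply: le_trans (nesterov_energy_step a L_gt0 convex_f smooth_f t1
  (y_average k) (x_rec _) (w_rec k)) _.
by rewrite lerD2r ler_wpM2r// subr_ge0.
Qed.

Let E_ge0 a k : argmin f a -> 0 <= E a k.
Proof.
move=> fa; rewrite addr_ge0// mulr_ge0 ?sqr_ge0 ?dotvv_ge0 ?subr_ge0//.
by rewrite divr_ge0// ltW.
Qed.

Let E_cvg a : argmin f a -> cvgn (E a).
Proof.
move=> fa; apply: (@near_nonincreasing_is_cvgn _ _ 0); last first.
  by apply: nearW => k; exact: E_ge0.
(* Monotonicity is claimed only from an index [N] on, past which all t_k are at least 1. *)
have [N _ tN] := t_ge1; exists N => // k Nk.
move=> m; elim: m => [|m IH].
  by rewrite leqn0 => /eqP ->.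
rewrite leq_eqVlt => /predU1P[->//|]; rewrite ltnS => km.
apply: le_trans (IH km); apply: E_nonincr => //; apply: tN.
exact: leqW (leq_trans Nk km).
Qed.

Let dot_w_cvg a b : argmin f a -> argmin f b ->
  cvgn (fun k => dotv (w k) (a - b)).
Proof.
move=> fa fb.
have fab : f a = f b by apply/le_anti; rewrite fa fb.
(* The function gaps cancel by [fab], and |w - b|^2 - |w - a|^2 = 2 <w, a - b> + |b|^2 - |a|^2. *)
rewrite [X in cvgn X](_ : _ = (fun k => L^-1 * (E b k - E a k) +
    (dotv a a - dotv b b) / 2)); last first.
  apply/funext => k; rewrite /E fab; move: (w k) => v.
  rewrite !dotvE !(dotvC _ v); field; exact: lt0r_neq0.
apply: is_cvgD; last exact: is_cvg_cst.
by apply: is_cvgMl_tmp; apply: is_cvgB; exact: E_cvg.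
Qed.

Let dot_x_cvg a b : argmin f a -> argmin f b ->
  cvgn (fun k => dotv (x k) (a - b)).
Proof.
move=> fa fb; apply/cvg_ex; exists (limn (fun k => dotv (w k) (a - b))).
apply: (weighted_average_cvg t_gt0 t_le t_ge1 _ (dot_w_cvg fa fb)) => k.
by rewrite x_average; move: (w k) => v; rewrite !(dotvDl, dotvZl, dotvNl).
Qed.

(** The energy is eventually at most some [C], whence 0 <= f(x_{k+1}) - f(a) <= C / t_k^2. *)
Let f_x_cvg a : argmin f a -> (fun k => f (x k) : R) @ \oo --> (f a : R).
Proof.
move=> fa; rewrite -cvg_shiftS.
have [C EC] : exists C, \forall k \near \oo, E a k <= C.
  by exists (limn (E a) + 1); apply: cvgr_le (E_cvg fa) _ _; rewrite ltrDl.
apply: (@squeeze_cvgr _ _ _ _ (cst (f a)) (fun k => f a + C * ((t k)^-1 * (t k)^-1))).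
- apply: filterS EC => k /= Ek; rewrite fa/= -lerBlDl -invfM -expr2.
  rewrite ler_pdivlMr ?exprn_gt0// mulrC; apply: le_trans Ek; rewrite /E lerDl.
  by rewrite mulr_ge0 ?dotvv_ge0// divr_ge0// ltW.
- exact: cvg_cst.
- have : (fun k => (f a : R) + C * ((t k)^-1 * (t k)^-1)) @ \oo -->
      (f a : R) + C * (0 * 0).
    by apply: cvgD; [exact: cvg_cst|apply: cvgM; [exact: cvg_cst|exact: cvgM]].
  by rewrite !mulr0 addr0.
Qed.

Let w_bounded a : argmin f a -> exists M, \forall k \near \oo, `|w k| <= M.
Proof.
move=> fa.
pose C := limn (E a) + 1.
have EC : \forall k \near \oo, E a k <= C.
  by apply: cvgr_le (E_cvg fa) _ _; rewrite ltrDl.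
(* The radius comes from L/2 |w_k - a|^2 <= E_k(a) <= C. *)
exists (`|a| + Num.sqrt (2 / L * C)); apply: filterS EC => k Ek.
rewrite -[w k](subrK a) addrC (le_trans (ler_normD _ _))// lerD//.
apply: le_trans (mx_norm_le_enorm _) _.
rewrite ler_wsqrtr// -ler_pdivrMl ?divr_gt0// invf_div.
apply: le_trans Ek; rewrite /E lerDr.
by rewrite mulr_ge0 ?sqr_ge0// subr_ge0.
Qed.

(** Once t_k >= 1, x_{k+1} is a convex combination of x_k and w_k, so it stays in any ball about 0
    containing x_N and all w_k with k >= N. *)
Let x_bounded a : argmin f a ->
  exists M, \forall k \near \oo, `|x k| <= M /\ `|w k| <= M.
Proof.
move=> /w_bounded[M wM].
have [N _ HN] := filterI t_ge1 wM.
exists (Num.max M `|x N|); exists N => // k /= Nk; split; last first.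
  by rewrite le_max; have [_ ->] := HN _ Nk.
elim: k Nk => [|k IH].
  by rewrite leqn0 => /eqP ->; rewrite le_max lexx orbT.
rewrite leq_eqVlt => /predU1P[<-|]; first by rewrite le_max lexx orbT.
rewrite ltnS => Nk; have [t1 wk] := HN _ Nk; have {}IH := IH Nk.
set B := Num.max _ _ in IH *.
have wB : `|w k| <= B by rewrite le_max wk.
have s0 : 0 < (t k)^-1 by rewrite invr_gt0.
have s1 : 0 <= 1 - (t k)^-1 by rewrite subr_ge0 invf_le1.
have -> : x k.+1 = (1 - (t k)^-1) *: x k + (t k)^-1 *: w k.
  by rewrite x_average scalerBl scale1r scalerBr addrA addrAC.
apply: le_trans (ler_normD _ _) _; rewrite !normrZ (ger0_norm s1) gtr0_norm//.
have -> : B = (1 - (t k)^-1) * B + (t k)^-1 * B by ring.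
by apply: lerD; rewrite ler_wpM2l// ltW.
Qed.

Let cluster_x_argmin a b : argmin f a -> cluster (x @ \oo) b -> argmin f b.
Proof.
move=> fa xb z.
have -> : f b = f a; last exact: fa.
apply: (@cluster_continuous_cvg _ R _ f _ _ _ xb) => //; last exact: f_x_cvg.
by apply: differentiable_continuous; have [] := smooth_f.
Qed.

Let cluster_x_unique a b c : argmin f c ->
  cluster (x @ \oo) a -> cluster (x @ \oo) b -> a = b.
Proof.
move=> fc xa xb.
have fa := cluster_x_argmin fc xa; have fb := cluster_x_argmin fc xb.
have cont v : {for v, continuous (fun u => dotv u (a - b))}.
  exact: dotv_continuous.
have da := cluster_continuous_cvg _ xa (cont _) (dot_x_cvg fa fb).
have db := cluster_continuous_cvg _ xb (cont _) (dot_x_cvg fa fb).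
by apply/subr0_eq/dotvv_eq0; rewrite dotvBl da db subrr.
Qed.

Lemma nesterov_cvg a : argmin f a -> exists xoo,
  argmin f xoo /\ x k @[k --> \oo] --> xoo /\ y k @[k --> \oo] --> xoo.
Proof.
move=> fa; have [M xwM] := x_bounded fa.
have xM : \forall k \near \oo, `|x k| <= M by apply: filterS xwM => k [].
have [b xb x_cvg] := bounded_unique_cluster_cvg xM (fun _ _ => cluster_x_unique fa).
exists b; split; first exact: cluster_x_argmin xb.
split=> //; rewrite -cvg_shiftS.
(* The limit of [x] passes to [y] because their difference is a bounded vector times a factor
   tending to 0. *)
have yE k : y k.+1 = x k.+1 + (t k.+1)^-1 *: (w k - x k.+1).
  rewrite -[LHS]scale1r -(mulVf (lt0r_neq0 (t_gt0 k.+1))) -scalerA y_average.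
  rewrite scalerDr scalerA mulrBr mulVf ?gt_eqF// mulr1 scalerBl scale1r.
  by rewrite scalerBr addrA addrAC.
have tV0 : (fun k => (t k.+1)^-1) @ \oo --> (0 : R).
  by rewrite (cvg_shiftS (fun k => (t k)^-1)).
have xS : (fun k => x k.+1) @ \oo --> b by rewrite cvg_shiftS.
suff wx0 : (fun k => (t k.+1)^-1 *: (w k - x k.+1)) @ \oo --> (0 : 'rV[R]_n).
  by rewrite (funext yE); have := cvgD xS wx0; rewrite addr0; apply.
apply/cvgr0Pnorm_le => e e0.
(* The absolute value and the added 1 make the bound a positive divisor for [e]. *)
have M0 : 0 < `|M| + 1 by rewrite ltr_wpDl.
have eM0 : 0 < e / ((`|M| + 1) *+ 2) by rewrite divr_gt0 ?mulrn_wgt0.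
have xSM : \forall k \near \oo, `|x k.+1| <= M.
  by have [N _ HN] := xM; exists N => // k Nk; apply: HN; exact: leqW.
have /cvgr0Pnorm_le/(_ _ eM0) tVe := tV0.
apply: filterS3 xwM xSM tVe => k [_ wk] xk tk.
rewrite normrZ.
have M1 : `|w k - x k.+1| <= (`|M| + 1) *+ 2.
  have := ler_normB (w k) (x k.+1); have := ler_norm M; rewrite mulr2n; lra.
apply: le_trans (ler_pM _ _ tk M1) _ => //.
by rewrite divfK// gt_eqF// mulrn_wgt0.
Qed.

End Nesterov.
Theorem theorem3p5 (R : realType) (n : nat) (L : R) (f : 'rV[R]_n -> R^o)
    (t : nat -> R) (x y : nat -> 'rV[R]_n) :
  0 < L ->
  convex_function [set: convex_lmodType 'rV[R]_n] f ->
  Lsmooth L f ->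
  argmin f !=set0 ->
  (forall k, 0 < t k) ->
  t 0%N = 1 ->
  (forall k, t k.+1 ^+ 2 - t k.+1 <= t k ^+ 2) ->
  t k @[k --> \oo] --> +oo ->
  x 0%N = y 0%N ->
  (forall k, x k.+1 = y k - L^-1 *: gradient f (y k)) ->
  (forall k, y k.+1 =
     x k.+1 + ((t k - 1) / t k.+1) *: (x k.+1 - x k)) ->
  exists xoo : 'rV[R]_n,
    argmin f xoo /\
    (x k @[k --> \oo] --> xoo) /\
    (y k @[k --> \oo] --> xoo).

Proof.
move=> L0 cf sf [a fa] t_gt0 t0 t_rec t_cvgy _ x_rec y_rec.
exact: (nesterov_cvg L0 cf sf t_gt0 t0 t_rec t_cvgy x_rec y_rec fa).
Qed.
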